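(* In any topologically semiperfect topological ring $\mathfrak R$, the topological Jacobson radical $\mathfrak H(\mathfrak R)$ is equal to the topological closure of the Jacobson radical $H(\mathfrak R)$, that is, $\mathfrak H(\mathfrak R)=\overline{H(\mathfrak R)}$.
   Context: All rings are associative and unital. All topological rings are complete, separated and right linear: open right ideals $\mathfrak I$ form a base of neighborhoods of zero and $\mathfrak R\to\varprojlim_{\mathfrak I}\mathfrak R/\mathfrak I$ is bijective. A family $(r_x)_{x\in X}$ in $\mathfrak R$ is zero-convergent if every open right ideal contains $r_x$ for all but finitely many $x$; infinite sums of zero-convergent families are limits of finite partial sums. A nonzero ring is local if its noninvertible elements form an additive subgroup. $\mathfrak R$ is topologically semiperfect if there exist a set $Z$ and a zero-convergent family $(e_z)_{z\in Z}$ of pairwise orthogonal idempotents in $\mathfrak R$ with $\sum_{z\in Z}e_z=1$ such that every ring $e_z\mathfrak R e_z$ is local. $H(\mathfrak R)$ is the usual (abstract) Jacobson radical of $\mathfrak R$ regarded as a ring without topology. The topological Jacobson radical $\mathfrak H(\mathfrak R)$ is the intersection of all open maximal right ideals of $\mathfrak R$. *)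

(* Defs.v *)
From HB Require Import structures.
From mathcomp Require Import all_boot all_algebra.
From mathcomp Require Import boolp classical_sets functions cardinality.
From mathcomp Require Import topology normedtype tvs.
From mathcomp Require summability.

Set Implicit Arguments.
Unset Strict Implicit.
Unset Printing Implicit Defensive.

Import GRing.Theory.

Local Open Scope classical_set_scope.
Local Open Scope ring_scope.

(* Rings are [pzRingType]s: associative and unital, not necessarily
   commutative, and the zero ring is allowed. *)

HB.mixin Record TopologicalZmodule_isTopologicalPzRing M
    & Topological M & GRing.PzRing M := {
  mul_continuous : continuous (fun x : M * M => x.1 * x.2) ;
}.

#[short(type="topologicalPzRingType")]
HB.structure Definition TopologicalPzRing :=
  {M of TopologicalZmodule M & GRing.PzRing M
        & TopologicalZmodule_isTopologicalPzRing M}.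

Definition additive_subgroup (V : zmodType) (A : set V) : Prop :=
  A 0 /\ forall x y, A x -> A y -> A (x - y).

Definition right_ideal (R : pzRingType) (I : set R) : Prop :=
  additive_subgroup I /\ forall x r, I x -> I (x * r).

Definition maximal_right_ideal (R : pzRingType) (I : set R) : Prop :=
  [/\ right_ideal I, I <> setT &
      forall J, right_ideal J -> I `<=` J -> J = I \/ J = setT].

Definition jacobson_radical (R : pzRingType) : set R :=
  \bigcap_(M in [set M : set R | maximal_right_ideal M]) M.
Arguments jacobson_radical R : clear implicits.

Definition invertible (R : pzRingType) (x : R) : Prop :=
  exists y, x * y = 1 /\ y * x = 1.

Definition local_ring (R : pzRingType) : Prop :=
  (1 : R) <> 0 /\ additive_subgroup [set x : R | ~ invertible x].

Definition idempotent_elt (R : pzRingType) (e : R) : Prop := e * e = e.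

Definition in_corner (R : pzRingType) (e : R) : {pred R} :=
  fun x => `[< exists y, x = e * y * e >].

Lemma in_cornerP (R : pzRingType) (e x : R) :
  reflect (exists y, x = e * y * e) (x \in in_corner e).
Proof. exact: asboolP. Qed.

Lemma in_corner_zmod_closed (R : pzRingType) (e : R) :
  zmod_closed (in_corner e).
Proof.
split; first by apply/in_cornerP; exists 0; rewrite mulr0 mul0r.
move=> _ _ /in_cornerP[x ->] /in_cornerP[y ->]; apply/in_cornerP.
by exists (x - y); rewrite mulrBr mulrBl.
Qed.

HB.instance Definition _ (R : pzRingType) (e : R) :=
  GRing.isZmodClosed.Build R (in_corner e) (in_corner_zmod_closed e).

(* The ring [e R e], whose unit is [e]; the proof that [e] is idempotent is a
   parameter of the type so that the ring structure below can be canonical. *)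
Record corner (R : pzRingType) (e : R) (ide : idempotent_elt e) := Corner {
  corner_val : R;
  corner_valP : corner_val \in in_corner e }.

Section CornerRing.
Variables (R : pzRingType) (e : R) (ide : idempotent_elt e).

HB.instance Definition _ := [isSub of corner ide for @corner_val R e ide].
HB.instance Definition _ := [Choice of corner ide by <:].
HB.instance Definition _ := [SubChoice_isSubZmodule of corner ide by <:].

Implicit Types x y z : corner ide.

Let corner1_subproof : e \in in_corner e.
Proof. by apply/in_cornerP; exists 1; rewrite mulr1 ide. Qed.

Let cornerM_subproof x y : corner_val x * corner_val y \in in_corner e.
Proof.
have /in_cornerP[a ->] := corner_valP x; have /in_cornerP[b ->] := corner_valP y.
by apply/in_cornerP; exists (a * e * (e * b)); rewrite !mulrA.
Qed.

Definition corner_one : corner ide := Corner ide corner1_subproof.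
Definition corner_mul x y : corner ide := Corner ide (cornerM_subproof x y).

Let corner_mulA : associative corner_mul.
Proof. by move=> x y z; apply: val_inj; rewrite /= mulrA. Qed.

Let corner_mul1r : left_id corner_one corner_mul.
Proof.
move=> x; apply: val_inj => /=.
by have /in_cornerP[a ->] := corner_valP x; rewrite !mulrA ide.
Qed.

Let corner_mulr1 : right_id corner_one corner_mul.
Proof.
move=> x; apply: val_inj => /=.
by have /in_cornerP[a ->] := corner_valP x; rewrite -!mulrA ide.
Qed.

Let corner_mulDl : left_distributive corner_mul +%R.
Proof. by move=> x y z; apply: val_inj; rewrite /= mulrDl. Qed.

Let corner_mulDr : right_distributive corner_mul +%R.
Proof. by move=> x y z; apply: val_inj; rewrite /= mulrDr. Qed.

HB.instance Definition _ := GRing.Zmodule_isPzRing.Build (corner ide)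
  corner_mulA corner_mul1r corner_mulr1 corner_mulDl corner_mulDr.

End CornerRing.

Section TopologicalRing.
Variable R : topologicalPzRingType.

Definition open_right_ideal (I : set R) : Prop := open I /\ right_ideal I.

Definition right_linear : Prop :=
  forall U : set R, nbhs 0 U -> exists2 I, open_right_ideal I & I `<=` U.

Definition add_coset (I : set R) (a : R) : set R := [set a + x | x in I].

(* The limit of the quotients [R/I] over the open right ideals [I]. The
   transition map [R/I -> R/J], for [I] contained in [J], sends a coset of [I]
   to the only coset of [J] that contains it. *)
Definition lim_quotients : set ({I : set R | open_right_ideal I} -> set R) :=
  [set c | (forall I, range (add_coset (sval I)) (c I)) /\
           forall I J, sval I `<=` sval J -> c I `<=` c J].

Definition complete_separated : Prop :=
  set_bij setT lim_quotients (fun a I => add_coset (sval I) a).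

Definition zero_convergent (X : Type) (r : X -> R) : Prop :=
  forall I, open_right_ideal I -> finite_set [set x | ~ I (r x)].

(* [totally] is the filter of the directed set of finite subsets of [X]. *)
Definition has_sum (X : choiceType) (r : X -> R) (s : R) : Prop :=
  summability.partial_sum r A @[A --> summability.totally] --> s.

Definition topologically_semiperfect : Prop :=
  exists (Z : choiceType) (e : Z -> R) (ide : forall z, idempotent_elt (e z)),
    [/\ forall z w, z <> w -> e z * e w = 0,
        zero_convergent e,
        has_sum e 1 &
        forall z, local_ring (corner (ide z))].

Definition topological_jacobson_radical : set R :=
  \bigcap_(M in [set M | open M /\ maximal_right_ideal M]) M.

End TopologicalRing.

Arguments right_linear R : clear implicits.
Arguments complete_separated R : clear implicits.
Arguments topologically_semiperfect R : clear implicits.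
Arguments topological_jacobson_radical R : clear implicits.

(* Main.v *)
Require Import Defs.
From mathcomp Require Import all_boot all_algebra.
From mathcomp Require Import boolp.
From mathcomp Require Import classical_sets topology tvs.
From mathcomp Require summability.

(** Every open right ideal is closed, so the intersection of the open maximal
    right ideals is a closed set containing [H(R)]; this gives one inclusion.

    Conversely let [r] lie in the topological radical. The finite partial sums
    of [sum_z e_z r] converge to [r] because right multiplication by [r] is
    continuous, and [H(R)] is closed under addition, so it is enough that
    [e r] lies in [H(R)] for each [e = e_z]. This amounts to [1 - e r s] being
    right invertible for all [s]. Write [t = r s]. As [e R e] is local, [e t e]
    or [e - e t e] is invertible in it.
    - If [e - e t e] has the inverse [y], then [1 + y t] is a right inverse of
      [1 - e t] ([local_corner_right_inv]).
    - If [e t e] is invertible, then [e] lies in the topological radical, which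
      is a two-sided ideal ([topological_jacobson_radicalMl]). This is
      impossible: by separation some open right ideal [I] misses [e], the open
      right ideal of all [x] with [e x] in [I] contains [1 - e] but not [1],
      and a maximal right ideal above it is open and misses [e]
      ([idempotent_notin_topological_jacobson_radical]). *)

Set Implicit Arguments.
Unset Strict Implicit.
Unset Printing Implicit Defensive.

Import GRing.Theory.

Local Open Scope classical_set_scope.
Local Open Scope ring_scope.

(** * Right ideals and the Jacobson radical *)

Lemma right_idealD (R : pzRingType) (I : set R) x y :
  right_ideal I -> I x -> I y -> I (x + y).
Proof.
case=> -[I0 IB] _ Ix Iy; have INy : I (- y) by rewrite -[- y]sub0r; apply IB.
by rewrite -[y]opprK; exact: IB.
Qed.

Lemma right_idealT (R : pzRingType) (I : set R) :
  right_ideal I -> I 1 -> I = setT.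
Proof.
by case=> _ IM I1; apply/seteqP; split=> // x _; rewrite -[x]mul1r; exact: IM.
Qed.

Lemma maximal_right_ideal_proper (R : pzRingType) (M : set R) :
  maximal_right_ideal M -> ~ M 1.
Proof. by case=> Mid MT _ M1; apply: MT; exact: right_idealT. Qed.

(** This is the equality [M + x R = R]: its left side is a right ideal properly
    containing [M]. *)
Lemma maximal_right_ideal_span (R : pzRingType) (M : set R) x y :
  maximal_right_ideal M -> ~ M x -> exists s, M (y - x * s).
Proof.
case=> -[[M0 MB] MM] MT Mmax Mx.
pose J := [set y : R | exists s, M (y - x * s)].
have Jid : right_ideal J.
  split; first split; first by exists 0; rewrite mulr0 subr0.
    move=> a b [s Ms] [t Mt]; exists (s - t).
    by rewrite mulrBr opprD addrACA -opprD; exact: MB.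
  by move=> a r [s Ms]; exists (s * r); rewrite mulrA -mulrBl; exact: MM.
have MJ : M `<=` J by move=> a Ma; exists 0; rewrite mulr0 subr0.
have [JM|JT] := Mmax _ Jid MJ; last by have : J y by rewrite JT.
by exfalso; apply: Mx; rewrite -JM; exists 1; rewrite mulr1 subrr.
Qed.

(** Zorn's lemma applied to the proper right ideals above [I]. The bare
    [Zorn_bigcup] asks for the union of the empty chain as well, hence the
    order is set up on arbitrary sets [A] through the ideals [A `|` I]. *)
Lemma ex_maximal_right_ideal (R : pzRingType) (I : set R) :
  right_ideal I -> ~ I 1 -> exists2 M, maximal_right_ideal M & I `<=` M.
Proof.
move=> Iid I1.
pose P (A : set R) := right_ideal (A `|` I) /\ ~ (A `|` I) 1.
have chainP (F : set (set R)) : F `<=` P -> total_on F subset ->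
    P (\bigcup_(X in F) X).
  move=> FP Ftot; have [->|/set0P[X0 FX0]] := eqVneq F set0.
    by rewrite bigcup_set0 /P set0U.
  (* Two elements of the union lie in a common [X `|` I] of the chain. *)
  have common x y : (\bigcup_(X in F) X `|` I) x ->
      (\bigcup_(X in F) X `|` I) y ->
      exists X, [/\ F X, (X `|` I) x & (X `|` I) y].
    case=> [[X FX Xx]|Ix] [[Y FY Yy]|Iy].
    - have [XY|YX] := Ftot _ _ FX FY.
        by exists Y; split=> //; left => //; exact: XY.
      by exists X; split=> //; left => //; exact: YX.
    - by exists X; split=> //; [left|right].
    - by exists Y; split=> //; [right|left].
    - by exists X0; split=> //; right.
  have incl X : F X -> X `|` I `<=` \bigcup_(X in F) X `|` I.
    by move=> FX x [Xx|Ix]; [left; exists X|right].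
  split; first split; first split.
  - by right; case: Iid => -[].
  - move=> x y xF yF; have [X [FX Xx Xy]] := common _ _ xF yF.
    by apply: (incl _ FX); case: (FP _ FX) => -[[_ XB] _] _; exact: XB.
  - move=> x r xF; have [X [FX Xx _]] := common _ _ xF xF.
    by apply: (incl _ FX); case: (FP _ FX) => -[_ XM] _; exact: XM.
  - by move=> F1; have [X [/FP[_ X1] ? _]] := common _ _ F1 F1; exact: X1.
have [A [[Aid A1] Amax]] := Zorn_bigcup chainP.
exists (A `|` I); last exact: subsetUr.
split=> // [AT|J Jid AJ]; first by apply: A1; rewrite AT.
have IJ : I `<=` J by apply: subset_trans AJ; exact: subsetUr.
have [J1|J1] := pselect (J 1); first by right; exact: right_idealT.
left; have JI : J `|` I = J by apply/setUidPl.
have [JA|JA] := pselect (J `<=` A).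
  by apply/seteqP; split=> // x /JA; left.
exfalso; apply: (Amax J); last by split; rewrite JI.
by split=> //; apply: subset_trans AJ; exact: subsetUl.
Qed.

Definition colon (R : pzRingType) (I : set R) (a : R) : set R :=
  [set r | I (a * r)].

Lemma colon_right_ideal (R : pzRingType) (I : set R) a :
  right_ideal I -> right_ideal (colon I a).
Proof.
case=> -[I0 IB] IM; rewrite /colon; split; first split => /=.
- by rewrite mulr0.
- by move=> x y Ix Iy; rewrite mulrBr; exact: IB.
- by move=> x r Ix /=; rewrite mulrA; exact: IM.
Qed.

(** [colon M a] is the annihilator of the class of [a] in the simple module
    [R / M], which that class generates. *)
Lemma colon_maximal_right_ideal (R : pzRingType) (M : set R) a :
  maximal_right_ideal M -> ~ M a -> maximal_right_ideal (colon M a).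
Proof.
move=> Mmax Ma; have [Mid _ _] := Mmax.
split; first exact: colon_right_ideal.
  by move=> MT; apply: Ma; rewrite -[a]mulr1 -[M _]/(colon M a 1) MT.
move=> J Jid MJ.
have [JM|/existsNP[j /not_implyP[Jj Mj]]] := pselect (J `<=` colon M a).
  by left; apply/seteqP.
right; apply: right_idealT => //.
have [s Ms] := maximal_right_ideal_span a Mmax Mj.
rewrite -[1](subrK (j * s)); apply: right_idealD => //; last by apply Jid.2.
by apply: MJ; rewrite /colon /= mulrBr mulr1 mulrA.
Qed.

(** If [x] is outside a maximal right ideal [M], then [1 - x s] is in [M] for
    some [s], and an element of [M] has no right inverse. *)
Lemma jacobson_radicalP (R : pzRingType) (x : R) :
  (forall s, exists u, (1 - x * s) * u = 1) -> jacobson_radical R x.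
Proof.
move=> xqr M Mmax; apply: contrapT => Mx.
have [s Ms] := maximal_right_ideal_span 1 Mmax Mx.
have [u su1] := xqr s; apply: (maximal_right_ideal_proper Mmax).
by rewrite -su1; case: Mmax => -[_ MM] _ _; exact: MM.
Qed.

Lemma jacobson_radical_sum (R : pzRingType) (X : Type) (s : seq X) (f : X -> R) :
  (forall x, jacobson_radical R (f x)) -> jacobson_radical R (\sum_(x <- s) f x).
Proof.
move=> fH M Mmax; have [Mid _ _] := Mmax.
elim/big_ind: _ => [|? ? ? ?|x _]; first by case: Mid => -[].
  exact: right_idealD.
exact: fH.
Qed.

(** * Local corners *)

(** In the local ring [e R e] the elements [e t e] and [e - e t e] have sum [e],
    so one of them is invertible, and the hypothesis on [t] excludes the
    first. *)
Lemma local_corner_right_inv (R : pzRingType) (e : R) (ide : idempotent_elt e)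
    (t : R) :
  local_ring (corner ide) ->
  (forall y, e * t * e * y <> e) -> exists u, (1 - e * t) * u = 1.
Proof.
move=> [_ [_ locB]] teN.
have cornP y : e * y * e \in in_corner e by apply/in_cornerP; exists y.
pose a : corner ide := Corner ide (cornP t).
have aN : ~ invertible a.
  by case=> y [/(congr1 val) /= ay _]; exact: (teN (val y)).
have [y [/(congr1 val) /= ay _]] : invertible (1 - a).
  apply: contrapT => aN1.
  have NaN : ~ invertible (- a).
    case=> y [y1 y2]; apply: aN; exists (- y).
    by rewrite mulrN -mulNr y1 mulNr -mulrN y2.
  have := locB _ _ aN1 NaN; rewrite opprK subrK; apply; exists 1.
  by rewrite mulr1.
have /in_cornerP[c yE] := valP y.
have ey : e * val y = val y by rewrite yE !mulrA ide.
(* With [y] the inverse of [e - e t e], this identity turns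
   [1 = (1 - e t) + e t] into [1 = (1 - e t) (1 + y t)]. *)
have ty : (1 - e * t) * val y = e.
  by rewrite -[RHS]ay mulrBl mul1r !mulrBl ey -!mulrA ey.
by exists (1 + val y * t); rewrite mulrDr mulr1 mulrA ty subrK.
Qed.

(** * The topological Jacobson radical *)

Section Topology.
Variable R : topologicalPzRingType.

Lemma mulrl_continuous (a : R) : continuous (fun x : R => a * x).
Proof.
move=> x; apply: (@continuous2_cvg R R R R _ _ (fun=> a) id *%R);
  [|exact: cvg_cst|exact: cvg_id].
exact: (@Defs.mul_continuous R (a, x)).
Qed.

Lemma mulrr_continuous (a : R) : continuous (fun x : R => x * a).
Proof.
move=> x; apply: (@continuous2_cvg R R R R _ _ id (fun=> a) *%R);
  [|exact: cvg_id|exact: cvg_cst].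
exact: (@Defs.mul_continuous R (x, a)).
Qed.

Lemma subrl_continuous (a : R) : continuous (fun x : R => a - x).
Proof.
move=> x; apply: (@continuous2_cvg R R R R _ _ (fun=> a) id (fun y z => y - z));
  [|exact: cvg_cst|exact: cvg_id].
exact: (@sub_continuous R (a, x)).
Qed.

Lemma subrr_continuous (a : R) : continuous (fun x : R => x - a).
Proof.
move=> x; apply: (@continuous2_cvg R R R R _ _ id (fun=> a) (fun y z => y - z));
  [|exact: cvg_id|exact: cvg_cst].
exact: (@sub_continuous R (x, a)).
Qed.

(** [J] contains the neighbourhood [x + I] of each of its points [x]. *)
Lemma open_right_ideal_sup (I J : set R) :
  open_right_ideal I -> right_ideal J -> I `<=` J -> open J.
Proof.
move=> [Iop [[I0 _] _]] Jid IJ; rewrite openE => x Jx; rewrite /interior /=.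
have nI : nbhs (x - x) I by rewrite subrr; exact: open_nbhs_nbhs.
have nJ : nbhs x [set y | I (y - x)] by exact: subrr_continuous nI.
apply: filterS nJ => y /IJ Jyx.
by rewrite -[y](subrK x); exact: right_idealD.
Qed.

Lemma open_colon (I : set R) a : open I -> open (colon I a).
Proof. by apply: (open_comp (fun x _ => @mulrl_continuous a x)). Qed.

(** When [a] is outside the open maximal right ideal [M], the set [colon M a] is
    again an open maximal right ideal, so it contains [r]. *)
Lemma topological_jacobson_radicalMl (a r : R) :
  topological_jacobson_radical R r -> topological_jacobson_radical R (a * r).
Proof.
move=> rH M [Mop Mmax].
have [Ma|Ma] := pselect (M a); first by case: Mmax => -[_ MM] _ _; exact: MM.
apply: (rH (colon M a)); split; first exact: open_colon.
exact: colon_maximal_right_ideal.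
Qed.

Lemma topological_jacobson_radicalMr (a r : R) :
  topological_jacobson_radical R r -> topological_jacobson_radical R (r * a).
Proof.
by move=> rH M Mop; case: (Mop) => _ [[_ MM] _ _]; apply: MM; exact: rH.
Qed.

(** An element of all open right ideals has the same cosets as [0], and the map
    to the limit of the quotients is injective. *)
Lemma ex_open_right_ideal_notin (x : R) :
  complete_separated R -> x <> 0 -> exists2 I, open_right_ideal I & ~ I x.
Proof.
case=> _ inj _ x0; apply: contrapT => noI; apply: x0.
have Ix I : open_right_ideal I -> I x.
  by move=> Iop; apply: contrapT => Ix; apply: noI; exists I.
apply: inj; rewrite ?in_setT //; apply/funext => -[I Iop] /=.
have [_ Iid] := Iop; have [[I0 IB] _] := Iid.
apply/seteqP; split=> _ [y Iy <-].
  by exists (x + y); [apply: right_idealD => //; exact: Ix|rewrite add0r].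
by exists (y - x); [apply: IB => //; exact: Ix|rewrite add0r addrC subrK].
Qed.

(** Enlarging an open right ideal that misses [e] could produce one that is not
    maximal in [R]. Passing to [colon I e] avoids this: it contains [1 - e], so
    each proper right ideal above it misses [e]. *)
Lemma idempotent_notin_topological_jacobson_radical (e : R) :
  complete_separated R -> idempotent_elt e -> e <> 0 ->
  ~ topological_jacobson_radical R e.
Proof.
move=> Rsep ide e0 eH; have [I Iop Ie] := ex_open_right_ideal_notin Rsep e0.
have Cid : right_ideal (colon I e) by apply: colon_right_ideal; case: Iop.
have [|M Mmax CM] := ex_maximal_right_ideal Cid; first by rewrite /colon /= mulr1.
have Mop : open M.
  apply: (@open_right_ideal_sup (colon I e)) => //; last by case: Mmax.
  by split=> //; apply: open_colon; case: Iop.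
apply: (maximal_right_ideal_proper Mmax); rewrite -[1](subrK e).
have [Mid _ _] := Mmax; apply: right_idealD => //; last exact: eH.
by apply: CM; rewrite /colon /= mulrBr mulr1 ide subrr; case: Iop => _ [[]].
Qed.

Lemma local_idempotent_topological_jacobson_radical (e r : R)
    (ide : idempotent_elt e) :
  complete_separated R -> local_ring (corner ide) ->
  topological_jacobson_radical R r -> jacobson_radical R (e * r).
Proof.
move=> Rsep loc rH; apply: jacobson_radicalP => s; rewrite -mulrA.
apply: (local_corner_right_inv loc) => y ety.
have e0 : e <> 0 by move=> e0; apply: loc.1; apply: val_inj.
apply: (idempotent_notin_topological_jacobson_radical Rsep ide e0).
rewrite -ety -!mulrA; apply: topological_jacobson_radicalMl.
exact: topological_jacobson_radicalMr.
Qed.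

(** An element of the closure is congruent modulo any open right ideal to an
    element of the radical itself. *)
Lemma closure_jacobson_radical_sub :
  closure (jacobson_radical R) `<=` topological_jacobson_radical R.
Proof.
move=> x clx M [Mop Mmax]; have [Mid _ _] := Mmax.
have nM : nbhs (x - x) M.
  by rewrite subrr; apply: open_nbhs_nbhs; split=> //; case: Mid => -[].
have [y [Hy Mxy]] := clx _ (@subrl_continuous x x M nM).
by rewrite -[x](subrK y); apply: right_idealD => //; exact: Hy.
Qed.

End Topology.

Theorem corollary8p8 (R : topologicalPzRingType) :
  right_linear R -> complete_separated R -> topologically_semiperfect R ->
  topological_jacobson_radical R = closure (jacobson_radical R).
Proof.
move=> _ Rsep [Z [e [ide [_ _ sum1 loc]]]].
apply/seteqP; split; last exact: closure_jacobson_radical_sub.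
move=> r rH B; rewrite -{1}[r]mul1r => nB.
have totB := sum1 _ (@mulrr_continuous R r 1 _ nB).
have [A Br] := @filter_ex _ _ (summability.totally_filter) _ totB.
exists (summability.partial_sum e A * r); split=> //.
rewrite /summability.partial_sum mulr_suml; apply: jacobson_radical_sum => z.
exact: local_idempotent_topological_jacobson_radical.
Qed.
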